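(* Let $S$ be a star graph with a non-degenerate labeling $l_S \colon V(S) \to \mathbb{R}^{+}$. Then the following statements are equivalent: (i) The ultrametric space $(V(S), d_{l_S})$ is locally finite. (ii) The set $W_\varepsilon := \{v \in V(S) \colon l_S(v) \leq \varepsilon\}$ is finite for every $\varepsilon > 0$.
   Context: Graphs are simple and undirected; vertex sets may be infinite of any cardinality. A tree is a connected graph with nonempty vertex set and no cycles; any two distinct vertices of a tree are joined by exactly one (finite) path. A star graph is a tree $S$ having a vertex $c$ (the center) adjacent to every $v\in V(S)\setminus\{c\}$. $\mathbb{R}^+ = [0,\infty)$. A labeling of a tree $T$ is a map $l \colon V(T)\to\mathbb{R}^+$; it is non-degenerate if $\max\{l(u),l(v)\}>0$ for every edge $\{u,v\}\in E(T)$. Given a labeling $l$, define $d_l\colon V(T)\times V(T)\to\mathbb{R}^+$ by $d_l(u,u)=0$ and, for $u\neq v$, $d_l(u,v)=\max_{w\in V(P)} l(w)$, where $P$ is the path joining $u$ and $v$ in $T$ (endpoints included). It is known that $d_l$ is an ultrametric on $V(T)$ if and only if $l$ is non-degenerate. A subset $A$ of a metric space $(X,d)$ is bounded if $A\subseteq B_r(c)=\{x\in X\colon d(c,x)\le r\}$ for some $c\in X$, $r>0$. A metric space is locally finite if every bounded subset of it is finite. *)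

(* Defs.v *)
From HB Require Import structures.
From mathcomp Require Import all_boot all_order all_algebra.
From mathcomp Require Import all_classical all_reals all_analysis.

Set Implicit Arguments.
Unset Strict Implicit.
Unset Printing Implicit Defensive.

Import Order.TTheory GRing.Theory Num.Theory.

Local Open Scope classical_set_scope.
Local Open Scope ring_scope.

(* With the axioms of [boolp] every type carries a [choiceType] structure and
   every relation is boolean, so graphs of any cardinality are covered. *)
Record sgraph := SGraph {
  vertex :> choiceType;
  edge : rel vertex;
  edge_sym : symmetric edge;
  edge_irrefl : irreflexive edge }.

Section Graphs.
Variable G : sgraph.

(* [u :: p] lists the successive vertices of the path. *)
Definition is_path (u v : G) (p : seq G) : Prop :=
  [/\ path (@edge G) u p, last u p = v & uniq (u :: p)].

Definition connected_graph : Prop :=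
  forall u v : G, exists p, is_path u v p.

Definition acyclic_graph : Prop :=
  forall s : seq G, (2 < size s)%N -> ~ ucycle (@edge G) s.

Definition is_tree : Prop :=
  [/\ (exists v : G, True), connected_graph & acyclic_graph].

Definition is_star : Prop :=
  is_tree /\ exists c : G, forall v : G, v != c -> edge c v.

(* In a tree, the set from which [xget] selects has exactly one element. *)
Definition path_between (u v : G) : seq G :=
  xget [::] [set p | is_path u v p].

Variable R : realType.

Definition labeling (l : G -> R) : Prop := forall v, 0 <= l v.

Definition non_degenerate (l : G -> R) : Prop :=
  forall u v : G, edge u v -> 0 < Num.max (l u) (l v).

(* For [u != v] this is the maximum of [l] over [u :: path_between u v]. *)
Definition label_dist (l : G -> R) (u v : G) : R :=
  if u == v then 0 else \big[Num.max/l u]_(w <- path_between u v) l w.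

End Graphs.

Section MetricNotions.
Variables (R : realType) (X : Type) (d : X -> X -> R).

Definition dist_ball (c : X) (r : R) : set X := [set x | d c x <= r].

Definition dist_bounded (A : set X) : Prop :=
  exists c r, 0 < r /\ A `<=` dist_ball c r.

Definition locally_finite_dist : Prop :=
  forall A : set X, dist_bounded A -> finite_set A.

End MetricNotions.

(* Main.v *)
Require Import Defs.
From HB Require Import structures.
From mathcomp Require Import all_boot all_order all_algebra.
From mathcomp Require Import all_classical all_reals all_analysis.

Import Order.TTheory GRing.Theory Num.Theory.

Local Open Scope classical_set_scope.
Local Open Scope ring_scope.

(** Bounded sets are compared with the sublevel sets of the labeling.

    The label of an endpoint never exceeds the distance
    ([label_le_label_dist]), so a ball of radius [r] around [a] lies in the
    sublevel set at level [r] enlarged by the point [a]; finite sublevel sets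
    therefore make bounded sets finite.

    Conversely, in a tree adjacent vertices are joined by their edge alone
    ([label_dist_edge]), so the center [c] of the star is at distance
    [max (l c) (l v)] from every other vertex [v]. The sublevel set at level
    [eps] thus lies in the ball of radius [max eps (l c)] around [c], and local
    finiteness makes it finite. *)

Lemma path_betweenP {G : sgraph} (u v : G) :
  connected_graph G -> is_path u v (path_between u v).
Proof. by move=> /(_ u v) [p hp]; exact: (xgetPex [::] (ex_intro _ p hp)). Qed.

(** A longer path between adjacent vertices would be closed by their edge into
    a cycle. *)
Lemma acyclic_edge_path {G : sgraph} {u v : G} {p : seq G} :
  acyclic_graph G -> edge u v -> is_path u v p -> p = [:: v].
Proof.
move=> acG uv [up pv uniq_p]; case: p => [|x [|y p]] /= in up pv uniq_p *.
- by move: uv; rewrite pv edge_irrefl.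
- by rewrite pv.
- have [] := acG [:: u, x, y & p] isT; apply/andP; split => //.
  by move: up => /= /and3P[-> -> yp]; rewrite rcons_path yp /= pv edge_sym.
Qed.

Lemma label_dist_edge {R : realType} {G : sgraph} (l : G -> R) {u v : G} :
  is_tree G -> edge u v -> label_dist l u v = Num.max (l v) (l u).
Proof.
move=> [_ connG acG] uv; rewrite /label_dist ifF; last first.
  by apply/negP => /eqP uv_eq; move: uv; rewrite uv_eq edge_irrefl.
by rewrite (acyclic_edge_path acG uv (path_betweenP u v connG)) big_seq1_id.
Qed.

Lemma label_le_label_dist {R : realType} {G : sgraph} (l : G -> R) {u v : G} :
  connected_graph G -> u != v -> l v <= label_dist l u v.
Proof.
move=> connG uv; rewrite /label_dist (negbTE uv).
have [_ pv _] := path_betweenP u v connG.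
apply: le_bigmax_seq => //.
by have := mem_last u (path_between u v); rewrite pv inE eq_sym (negbTE uv).
Qed.

Theorem proposition5 (R : realType) (S : sgraph) (l : S -> R)
  (hS : is_star S) (hl : labeling l) (hnd : non_degenerate l) :
  locally_finite_dist (label_dist l) <->
  (forall eps : R, 0 < eps -> finite_set [set v : S | l v <= eps]).
Proof.
have [treeS [c cS]] := hS; split=> [lfS eps eps_gt0 | finW A [a [r [r_gt0 Ar]]]].
- apply: lfS; exists c, (Num.max eps (l c)); split; first by rewrite lt_max eps_gt0.
  move=> v /= lv; rewrite /dist_ball /=; have [->|vc] := eqVneq v c.
    by rewrite /label_dist eqxx le_max ltW.
  by rewrite (label_dist_edge l treeS (cS v vc)) ge_max !le_max lv lexx orbT.
- have [_ connS _] := treeS.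
  apply: (@sub_finite_set _ _ ([set a] `|` [set v | l v <= r])).
    move=> x /Ar; rewrite /dist_ball /= => ax; have [->|xa] := eqVneq x a.
      by left.
    by right; apply: le_trans ax; apply: label_le_label_dist; rewrite // eq_sym.
  by rewrite finite_setU; split; [exact: finite_set1 | exact: finW].
Qed.
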